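(* Let $a$ and $b$ satisfy the standing assumptions (K) and (B) of the context, let $g\in\mathcal G_b$, let $T\in(0,\infty]$, let $f^{\rm in}\in\Xi_0\cap\Xi_g^+$, and let $f$ be a weak solution on $[0,T)$ (in the sense of the context) to the collision-induced breakage equation with initial condition $f^{\rm in}$. Assume further that for all $t\in(0,T)$ $$s\mapsto\int_0^\infty\!\int_0^\infty y\,a(y,z)f(s,y)f(s,z)\,dy\,dz\ \in L^1(0,t).$$ Then $f$ is mass-conserving on $[0,T)$, i.e. $$\int_0^\infty xf(t,x)\,dx=\int_0^\infty xf^{\rm in}(x)\,dx,\qquad t\in[0,T).$$
   Context: **Equation.** The collision-induced breakage equation, for $t>0$, $x\in(0,\infty)$, is $$\partial_t f(t,x)=\int_0^\infty\!\int_x^\infty b(x,y,z)a(y,z)f(t,y)f(t,z)\,dy\,dz-\int_0^\infty a(x,y)f(t,x)f(t,y)\,dy,\qquad f(0,x)=f^{\rm in}(x).$$ **(K) Kernel.** $a(x,y)=a(y,x)\ge0$ has the form $a(x,y)=A_0\,\omega(x)\omega(y)$ with a constant $A_0>0$, where $\omega=\omega_0$ on $(0,1]$ and $\omega=\omega_\infty$ on $(1,\infty)$, $\omega_0,\omega_\infty:[0,\infty)\to[0,\infty)$ are continuous non-decreasing functions, and $\omega_0(x)\le A_1x^\ell$ for $x\in(0,1)$ with some $A_1>0$, $\ell\ge0$. **(B) Daughter distribution.** $b$ is a nonnegative measurable function on $(0,\infty)^3$ such that for all $(y,z)\in(0,\infty)^2$: $\int_0^y x\,b(x,y,z)\,dx=y$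 and $b(x,y,z)=0$ for $x>y$; $\int_0^y b(x,y,z)\,dx\le\beta_0$ for a constant $\beta_0\ge2$; and $\int_0^y b(x,y,z)^p\,dx\le \frac{B_p}{2}y^{1-p}$ for some constants $p\in(1,2)$, $B_p>0$. **Spaces.** For a measurable weight $g:(0,\infty)\to[0,\infty)$, $\Xi_g:=L^1((0,\infty),g(y)\,dy)$ and $\Xi_g^+$ is its cone of a.e. nonnegative functions; $\Xi_0=L^1(0,\infty)$; $\Xi_{0,w}$ is $\Xi_0$ with its weak topology. **Weights.** $\mathcal G_b$ is the set of $g\in L^1_{\rm loc}(\mathbb R_+)$ such that $g(x)>0$ for all $x>0$, $g(x)/x$ is non-decreasing on $(0,\infty)$, and, for some constant $\theta\in(0,1)$ depending only on $g$, $g(y)-\int_0^y g(x)b(x,y,z)\,dx\ge\theta g(y)$ for all $(y,z)\in(0,\infty)^2$. **Weak solution.** For $T\in(0,\infty]$, a weak solution on $[0,T)$ is a nonnegative $f\in\mathcal C([0,T);\Xi_{0,w})\cap L^\infty((0,T);\Xi_g^+)$ such that for all $t\in(0,T)$ the function $(s,x,y)\mapsto a(x,y)f(s,x)f(s,y)$ belongs to $L^1((0,t)\times(0,\infty)^2)$ and for all $\psi\in L^\infty(0,\infty)$ $$\int_0^\infty\psi(x)(f(t,x)-f^{\rm in}(x))\,dx=\int_0^t\!\int_0^\infty\!\int_0^\infty\tilde\psi(y,z)a(y,z)f(s,y)f(s,z)\,dy\,dz\,ds,$$ where $\tilde\psi(y,z):=\int_0^y\psi(x)b(x,y,z)\,dx-\psi(y)$.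 *)

(* Defs.v *)
From HB Require Import structures.
From mathcomp Require Import all_boot all_order all_algebra.
From mathcomp Require Import all_classical all_reals all_analysis.

Set Implicit Arguments.
Unset Strict Implicit.
Unset Printing Implicit Defensive.

Import Order.TTheory GRing.Theory Num.Theory.
Import numFieldNormedType.Exports.

Local Open Scope classical_set_scope.
Local Open Scope ring_scope.

(* Elements of L^1 and L^oo are represented by Borel functions R -> R, looked at
   on (0, oo) only; a function of (t, x) is a curried function R -> R -> R. *)

Section collision_breakage.
Variable R : realType.
Implicit Types (a : R -> R -> R) (b : R -> R -> R -> R).
Implicit Types (g h psi fin : R -> R) (f : R -> R -> R) (T : \bar R).

Local Notation mu := (@lebesgue_measure R).
Local Notation Rpos := (`]0, +oo[%classic : set R).

Record collision_kernel a : Prop := CollisionKernel {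
  kernel_sym : forall x y : R, 0 < x -> 0 < y -> a x y = a y x ;
  kernel_ge0 : forall x y : R, 0 < x -> 0 < y -> 0 <= a x y ;
  kernel_prod : exists (A0 A1 l : R) (omega omega0 omegaoo : R -> R),
    [/\ 0 < A0, 0 < A1 & 0 <= l] /\
    (forall x y : R, 0 < x -> 0 < y -> a x y = A0 * omega x * omega y) /\
    (forall x : R, 0 < x -> x <= 1 -> omega x = omega0 x) /\
    (forall x : R, 1 < x -> omega x = omegaoo x) /\
    [/\ forall x : R, 0 <= x -> 0 <= omega0 x,
        {within `[0, +oo[, continuous omega0} &
        forall x y : R, 0 <= x -> x <= y -> omega0 x <= omega0 y] /\
    [/\ forall x : R, 0 <= x -> 0 <= omegaoo x,
        {within `[0, +oo[, continuous omegaoo} &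
        forall x y : R, 0 <= x -> x <= y -> omegaoo x <= omegaoo y] /\
    (forall x : R, 0 < x -> x < 1 -> omega0 x <= A1 * x `^ l) }.

Record daughter_distribution b : Prop := DaughterDistribution {
  daughter_measurable : measurable_fun (Rpos `*` (Rpos `*` Rpos))
    (fun q : R * (R * R) => b q.1 q.2.1 q.2.2) ;
  daughter_ge0 : forall x y z : R, 0 < x -> 0 < y -> 0 < z -> 0 <= b x y z ;
  daughter_mass : forall y z : R, 0 < y -> 0 < z ->
    (\int[mu]_(x in `]0%R, y[) (x * b x y z)%:E = y%:E)%E ;
  daughter_supp : forall x y z : R, 0 < y -> 0 < z -> y < x -> b x y z = 0 ;
  daughter_number : exists2 beta0 : R, 2 <= beta0 &
    forall y z : R, 0 < y -> 0 < z ->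
    (\int[mu]_(x in `]0%R, y[) (b x y z)%:E <= beta0%:E)%E ;
  daughter_Lp : exists p Bp : R, [/\ 1 < p, p < 2, 0 < Bp &
    forall y z : R, 0 < y -> 0 < z ->
    (\int[mu]_(x in `]0%R, y[) (b x y z `^ p)%:E
       <= (Bp / 2 * y `^ (1 - p))%:E)%E] }.

(* Xi g is the space L^1((0, oo), g(y) dy); its norm takes the value +oo outside
   of it. *)
Definition Xi g : set (R -> R) :=
  [set h : R -> R | measurable_fun Rpos h /\
           mu.-integrable Rpos (fun x => (h x * g x)%:E)].

Definition Xi_norm g h : \bar R := (\int[mu]_(x in Rpos) (`|h x| * g x)%:E)%E.

Definition nonneg_ae h : Prop := {ae mu, forall x : R, 0 < x -> 0 <= h x}.

Definition Xi_pos g : set (R -> R) := [set h : R -> R | Xi g h /\ nonneg_ae h].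

Definition Xi0 : set (R -> R) := Xi (cst 1).

Definition Linfty : set (R -> R) :=
  [set psi : R -> R | measurable_fun Rpos psi /\
             exists M : R, {ae mu, forall x : R, 0 < x -> `|psi x| <= M}].

(* Local integrability is required on (0, oo): since g(x)/x is non-decreasing,
   integrability near 0 is then automatic. *)
Record weight_class b g : Prop := WeightClass {
  weight_loc : locally_integrable Rpos g ;
  weight_gt0 : forall x : R, 0 < x -> 0 < g x ;
  weight_ratio : forall x y : R, 0 < x -> x <= y -> g x / x <= g y / y ;
  weight_gap : exists theta : R, [/\ 0 < theta, theta < 1 &
    forall y z : R, 0 < y -> 0 < z ->
    ((theta * g y)%:E
       <= (g y)%:E - \int[mu]_(x in `]0%R, y[) (g x * b x y z)%:E)%E] }.

(* Bounded linear functionals on L^1(0, oo). Boundedness by the L^1 seminorm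
   makes phi compatible with almost everywhere equality. *)
Definition Xi0_dual (phi : (R -> R) -> R) : Prop :=
  (forall (c : R) (u v : R -> R), Xi0 u -> Xi0 v ->
     phi (fun x => c * u x + v x) = c * phi u + phi v) /\
  (exists C : R, forall u : R -> R, Xi0 u ->
     ((`|phi u|)%:E <= C%:E * Xi_norm (cst 1%R) u)%E).

(* C([0, T); Xi0 with its weak topology), the latter being the initial topology
   for the bounded linear functionals. *)
Definition weakly_continuous T f : Prop :=
  (forall t : R, 0 <= t -> (t%:E < T)%E -> Xi0 (f t)) /\
  (forall phi : (R -> R) -> R, Xi0_dual phi ->
     {within [set t : R | 0 <= t /\ (t%:E < T)%E],
        continuous (fun t => phi (f t))}).

Definition Xi_simple g (u : R -> R -> R) : Prop :=
  exists (n : nat) (A : 'I_n -> set R) (h : 'I_n -> R -> R),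
    [/\ forall i, measurable (A i), forall i, Xi g (h i) &
        forall t x : R, u t x = \sum_(i < n) \1_(A i) t * h i x].

(* The Bochner space L^oo((0, T); Xi_pos g). *)
Record Bochner_Linfty g T f : Prop := BochnerLinfty {
  Bochner_measurable : exists2 u : nat -> R -> R -> R,
    forall n, Xi_simple g (u n) &
    {ae mu, forall t : R, 0 < t -> (t%:E < T)%E ->
       Xi_norm g (fun x => u n t x - f t x) @[n --> \oo] --> 0%E} ;
  Bochner_pos : {ae mu, forall t : R, 0 < t -> (t%:E < T)%E -> Xi_pos g (f t)} ;
  Bochner_bounded : exists M : R,
    {ae mu, forall t : R, 0 < t -> (t%:E < T)%E -> (Xi_norm g (f t) <= M%:E)%E} }.

Definition tilde b psi (y z : R) : R :=
  \int[mu]_(x in `]0%R, y[) (psi x * b x y z) - psi y.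

Record weak_solution a b g fin T f : Prop := WeakSolution {
  weak_sol_ge0 : forall t : R, 0 <= t -> (t%:E < T)%E -> nonneg_ae (f t) ;
  weak_sol_continuous : weakly_continuous T f ;
  weak_sol_bounded : Bochner_Linfty g T f ;
  weak_sol_integrable : forall t : R, 0 < t -> (t%:E < T)%E ->
    (mu \x (mu \x mu)%E)%E.-integrable (`]0, t[ `*` (Rpos `*` Rpos))
      (fun q : R * (R * R) =>
         (a q.2.1 q.2.2 * f q.1 q.2.1 * f q.1 q.2.2)%:E) ;
  weak_sol_eq : forall t : R, 0 < t -> (t%:E < T)%E -> forall psi : R -> R, Linfty psi ->
    \int[mu]_(x in Rpos) (psi x * (f t x - fin x)) =
    \int[mu]_(s in `]0, t[) \int[mu]_(z in Rpos) \int[mu]_(y in Rpos)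
      (tilde b psi y z * a y z * f s y * f s z) }.

End collision_breakage.

(* Main.v *)
Require Import Defs.
From HB Require Import structures.
From mathcomp Require Import all_boot all_order all_algebra.
From mathcomp Require Import all_classical all_reals all_analysis.
From mathcomp Require Import measurable_realfun.

Import Order.TTheory GRing.Theory Num.Theory.
Import numFieldNormedType.Exports.
Import HBNNSimple.

Local Open Scope classical_set_scope.
Local Open Scope ring_scope.

(** The idea is to test the weak formulation with the truncated identity
    [psi_n x = x] for [x <= n] and [psi_n x = 0] for [x > n], and to let [n] tend
    to infinity. The identity itself is not bounded, hence not admissible, and it
    would formally give a vanishing right-hand side because breakage conserves
    mass: the fragments of a particle of size [y] have total mass [y].

    For the truncation, the same local conservation shows that
    [tilde b psi_n y z] vanishes when [y <= n]; when [y > n] it is the mass of the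
    fragments of size at most [n], so it lies between [0] and [y]
    ([tilde_cutoff]). The truncated mass thus changes between times [0] and [t]
    by at most the integral of [y a(y,z) f(s,y) f(s,z)] over [s < t] and [y > n]
    ([flux_tail_bound]). That function is integrable on the whole space-time
    domain, by the extra integrability assumption and Tonelli's theorem
    ([integrable_mass_rate]), so its integral over the tail [y > n] tends to [0] by
    dominated convergence ([flux_tail_cvg0]). Meanwhile the truncated masses tend
    to the full masses by monotone convergence ([truncated_mass_cvg]), and the two
    limits, possibly infinite, agree ([cvge_eq_near]).

    The weak formulation speaks of positive times only. At [t = 0] the estimate
    is recovered by continuity: it holds uniformly on a right neighbourhood of [0],
    and the truncated mass is a bounded linear functional on [L^1], hence continuous
    along the solution ([flux_tail_bound0]). *)

(** * Comparison of integrals *)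

(** The integral of a nonnegative function is a supremum over the simple functions
    below it, and cutting such a simple function off on a measurable null set does
    not change its integral; so monotonicity holds for arbitrary functions. This
    lets the solution be replaced by its absolute value inside iterated integrals
    whose inner integrals are not known to be measurable. *)
Lemma le_integral_ae {d} {T : measurableType d} {R : realType}
    (mu : {measure set T -> \bar R}) (D : set T) (f g : T -> \bar R) :
  {ae mu, forall x, D x -> (f x <= g x)%E} ->
  (\int[mu]_(x in D) f x <= \int[mu]_(x in D) g x)%E.
Proof.
suff pos : forall u v : T -> \bar R, (forall x, 0 <= u x)%E ->
    (forall x, 0 <= v x)%E -> {ae mu, forall x, (u x <= v x)%E} ->
    (\int[mu]_x u x <= \int[mu]_x v x)%E.
  move=> [N [mN N0 fgN]]; rewrite 2!(integral_mkcond D) integralE [leRHS]integralE.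
  apply: leeB; apply: pos => [x|x|]; rewrite ?funepos_ge0 ?funeneg_ge0//.
    exists N; split => // x /= /negP; rewrite -ltNge => xN; apply: fgN => /= fgx.
    move: xN; apply/negP; rewrite -leNgt !funeposE !patchE; case: ifP => //.
    by rewrite inE => /fgx fg; rewrite ge_max !le_max fg lexx/= orbT.
  exists N; split => // x /= /negP; rewrite -ltNge => xN; apply: fgN => /= fgx.
  move: xN; apply/negP; rewrite -leNgt !funenegE !patchE; case: ifP => //.
  by rewrite inE => /fgx fg; rewrite ge_max !le_max leeN2 fg lexx/= orbT.
move=> u v u0 v0 [N [mN N0 uvN]].
rewrite [leLHS]ge0_integralTE// [leRHS]ge0_integralTE//.
apply: ge_ereal_sup => _ [h /= hu <-].
rewrite -integralT_nnsfun.
(* [h'] agrees with [h] almost everywhere and lies below [v] everywhere. *)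
pose h' := proj_nnsfun h (measurableC mN).
have -> : (\int[mu]_x (h x)%:E = \int[mu]_x (h' x)%:E)%E.
  apply: ge0_ae_eq_integral => //=; first by apply/measurable_EFinP.
  - by apply/measurable_EFinP; exact: (@measurable_funPT _ _ _ _ h').
  - by move=> x _; rewrite lee_fin.
  - by move=> x _; rewrite lee_fin; exact: (@fun_ge0 _ _ h').
  - exists N; split => // x /=; apply: contra_notP => xN _.
    by rewrite /h' /= mindicE mem_set ?mulr1.
rewrite integralT_nnsfun; apply: ereal_sup_ubound => /=; exists h' => //= x.
rewrite mindicE; have [xN|xN] := pselect (N x).
  by rewrite memNset ?mulr0//=; apply.
rewrite mem_set// mulr1 (le_trans (hu x))//.
by apply: contrapT => /uvN.
Qed.

(** The real-valued integral is [0] when the extended one is infinite, so the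
    bound survives even then; it can be iterated, since the majorant is allowed to
    be any extended-real function. *)
Lemma normr_Rintegral_le {d} {T : measurableType d} {R : realType}
    (mu : {measure set T -> \bar R}) (D : set T) (f : T -> R) (H : T -> \bar R) :
  (forall x, D x -> ((`|f x|)%:E <= H x)%E) ->
  ((`|\int[mu]_(x in D) f x|)%:E <= \int[mu]_(x in D) H x)%E.
Proof.
move=> fH; have H0 x : D x -> (0 <= H x)%E.
  by move=> /fH; apply: le_trans; rewrite lee_fin.
rewrite /Rintegral; set I := integral mu D _.
suff : (`|I| <= \int[mu]_(x in D) H x)%E.
  apply: le_trans; rewrite -/I; case: I => [r| |] //=; by rewrite normr0 leey.
have [I0|/ltW I0] := leP 0%E I.
  rewrite gee0_abs//; apply: le_integral_ae; apply: aeW => x Dx.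
  by apply: le_trans (fH _ Dx); rewrite lee_fin ler_norm.
rewrite lee0_abs// leeNl -integral_ge0N//; apply: le_integral_ae; apply: aeW => x Dx.
rewrite leeNl; apply: le_trans (fH _ Dx).
by rewrite -EFinN lee_fin -normrN ler_norm.
Qed.

(** * Tonelli's theorem on a box *)

Lemma sigma_finite_product {d1 d2} {T1 : measurableType d1} {T2 : measurableType d2}
    {R : realType} (m1 : {sigma_finite_measure set T1 -> \bar R})
    (m2 : {sigma_finite_measure set T2 -> \bar R}) :
  sigma_finite setT (m1 \x m2)%E.
Proof.
have /sigma_finiteP[F [TF ndF Foo]] := sigma_finiteT m1.
have /sigma_finiteP[G [TG ndG Goo]] := sigma_finiteT m2.
exists (fun n => F n `*` G n) => [|k].
  apply/esym/seteqP; split => // -[x y] _.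
  have [i _ Fx] : (\bigcup_n F n) x by rewrite -TF.
  have [j _ Gy] : (\bigcup_n G n) y by rewrite -TG.
  exists (maxn i j) => //; split => /=.
  - exact: (subsetPset _ _ (ndF _ _ (leq_maxl i j))).
  - exact: (subsetPset _ _ (ndG _ _ (leq_maxr i j))).
have [mF Fk] := Foo k; have [mG Gk] := Goo k.
split; first exact: measurableX.
by rewrite product_measure1E// lte_mul_pinfty// ge0_fin_numE.
Qed.

(** The product measure bundled with its sigma-finiteness, so that it can in turn
    be the second factor of a product. *)
Definition sigma_finite_prod {d1 d2} {T1 : measurableType d1}
    {T2 : measurableType d2} {R : realType}
    (m1 : {sigma_finite_measure set T1 -> \bar R})
    (m2 : {sigma_finite_measure set T2 -> \bar R}) :
    {sigma_finite_measure set (T1 * T2)%type -> \bar R} :=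
  HB.pack (m1 \x m2)%E
    (Measure_isSigmaFinite.Build _ _ _ (m1 \x m2)%E (sigma_finite_product m1 m2)).

(** Tonelli's theorem for three variables and a function measurable on a box only:
    the extension by zero is measurable everywhere. *)
Lemma tonelli_box {d1 d2 d3} {T1 : measurableType d1} {T2 : measurableType d2}
    {T3 : measurableType d3} {R : realType}
    (m1 : {sigma_finite_measure set T1 -> \bar R})
    (m2 : {sigma_finite_measure set T2 -> \bar R})
    (m3 : {sigma_finite_measure set T3 -> \bar R})
    (A : set T1) (B : set T2) (C : set T3) (h : T1 * (T2 * T3) -> \bar R) :
  measurable A -> measurable B -> measurable C ->
  measurable_fun (A `*` (B `*` C)) h -> (forall q, 0 <= h q)%E ->
  (\int[m1 \x sigma_finite_prod m2 m3]_(q in A `*` (B `*` C)) h q =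
   \int[m1]_(s in A) \int[m3]_(z in C) \int[m2]_(y in B) h (s, (y, z)))%E.
Proof.
move=> mA mB mC mh h0.
have mE : measurable (A `*` (B `*` C)) by do 2 apply: measurableX => //.
have mhE := (measurable_restrictT _ mE).1 mh.
have hE0 q : (0 <= (h \_ (A `*` (B `*` C))) q)%E by rewrite patchE; case: ifP.
rewrite integral_mkcond fubini_tonelli1//.
rewrite [RHS]integral_mkcond; apply: eq_integral => s _.
rewrite /fubini_F (fubini_tonelli2 (m1 := m2))//=; last first.
  exact: (measurableT_comp mhE).
rewrite patchE; case: ifPn => As; last first.
  apply: integral0_eq => z _; apply: integral0_eq => y _.
  by rewrite patchE memNset// => -[/= ? _]; move: As; rewrite notin_setE; exact.
rewrite [RHS]integral_mkcond; apply: eq_integral => z _.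
rewrite /fubini_G patchE; case: ifPn => Cz; last first.
  apply: integral0_eq => y _.
  rewrite patchE memNset// => -[/= _ [/= _ ?]].
  by move: Cz; rewrite notin_setE; exact.
rewrite [RHS]integral_mkcond; apply: eq_integral => y _.
rewrite !patchE; congr (if _ then _ else _).
apply/idP/idP; rewrite !inE => //=; first by case => _ [].
by move=> By; move: As Cz; rewrite !inE.
Qed.

(** * Tails of an integrable function *)

Definition tail {T : Type} {R : realType} (w k : T -> R) (n : nat) (q : T) : R :=
  if n%:R < w q then `|k q| else 0.

Lemma measurable_tail {d} {T : measurableType d} {R : realType} (D : set T)
    (w k : T -> R) (n : nat) :
  measurable D -> measurable_fun D w -> measurable_fun D k ->
  measurable_fun D (tail w k n).
Proof.
move=> mD mw mk; apply: measurable_fun_if => //.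
- exact: measurable_fun_ltr.
- apply: measurableT_comp => //; exact: measurable_funS mk.
Qed.

Lemma integrable_tail {d} {S : measurableType d} {R : realType}
    (m : {measure set S -> \bar R}) (D : set S) (w k : S -> R) n :
  measurable D -> measurable_fun D w ->
  m.-integrable D (EFin \o k) ->
  m.-integrable D (fun q => (tail w k n q)%:E).
Proof.
move=> mD mw ik; apply: (le_integrable mD _ _ ik).
- apply/measurable_EFinP; apply: measurable_tail => //.
  by apply/measurable_EFinP; exact: (measurable_int m).
- move=> q _; rewrite /= lee_fin /tail; case: ifP => _; first by rewrite normr_id.
  by rewrite normr0.
Qed.

(** Dominated convergence: at each point the tail vanishes as soon as [n] exceeds
    the value of [w] there, and it is dominated by [`|k|]. *)
Lemma integral_tail_cvg0 {d} {T : measurableType d} {R : realType}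
    (mu : {measure set T -> \bar R}) (D : set T) (w k : T -> R) :
  measurable D -> measurable_fun D w -> mu.-integrable D (EFin \o k) ->
  (\int[mu]_(q in D) (tail w k n q)%:E @[n --> \oo] --> 0)%E.
Proof.
move=> mD mw ik; have mk : measurable_fun D k.
  by apply/measurable_EFinP; exact: (measurable_int mu).
rewrite -(integral0 mu D).
apply: (@dominated_cvg _ _ _ mu D mD _ _ (fun q => `|k q|%:E)) => //.
- by move=> n; apply/measurable_EFinP/measurable_tail.
- move=> q Dq; apply: cvg_near_cst.
  exists (Num.truncn `|w q|).+1 => // n /= wn; rewrite /tail ifF//.
  apply/negbTE; rewrite -leNgt (le_trans (ler_norm _))// ltW//.
  by rewrite (lt_le_trans (truncnS_gt _))// ler_nat.
- exact: (integrable_norm ik).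
- move=> n q Dq; rewrite /tail; case: ifPn => _; rewrite /= lee_fin ?normr_id//.
  by rewrite normr0.
Qed.

(** Working with extended limits and an error tending to [0] avoids the difference
    [U - V], which is meaningless when both limits are infinite. *)
Lemma cvge_eq_near {R : realType} (u v e : nat -> R) (U V : \bar R) :
  (u n)%:E @[n --> \oo] --> U -> (v n)%:E @[n --> \oo] --> V ->
  (e n)%:E @[n --> \oo] --> 0%E -> (forall n, `|u n - v n| <= e n) -> U = V.
Proof.
suff half : forall (u v : nat -> R) (U V : \bar R),
    (u n)%:E @[n --> \oo] --> U -> (v n)%:E @[n --> \oo] --> V ->
    (e n)%:E @[n --> \oo] --> 0%E -> (forall n, `|u n - v n| <= e n) -> (U <= V)%E.
  move=> uU vV e0 uv; apply/eqP; rewrite eq_le (half u v)//= (half v u)// => n.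
  by rewrite distrC.
move=> {}u {}v {}U {}V uU vV e0 uv.
have veV : ((v n)%:E + (e n)%:E)%E @[n --> \oo] --> (V + 0)%E.
  by apply: cvgeD => //; rewrite fin_num_adde_defl.
rewrite -[leRHS]adde0 -(cvg_lim _ uU)// -(cvg_lim _ veV)//.
apply: lee_lim; [by apply/cvg_ex; exists U|by apply/cvg_ex; exists (V + 0)%E|].
apply: nearW => n; rewrite -EFinD lee_fin addrC -lerBlDr.
exact: le_trans (ler_norm _) (uv n).
Qed.

(** * Truncated masses *)

Section mass.
Context {R : realType}.
Local Notation mu := (@lebesgue_measure R).
Local Notation Rpos := (`]0, +oo[%classic : set R).

Definition cutoff (n : nat) (x : R) : R := if x <= n%:R then x else 0.

Lemma cutoff_ge0 n x : 0 <= x -> 0 <= cutoff n x.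
Proof. by rewrite /cutoff; case: ifP. Qed.

Lemma cutoff_le n x : 0 <= x -> cutoff n x <= x.
Proof. by rewrite /cutoff; case: ifP. Qed.

Lemma cutoff_bound n x : 0 <= x -> `|cutoff n x| <= n%:R.
Proof. by move=> x0; rewrite ger0_norm ?cutoff_ge0// /cutoff; case: ifP. Qed.

Lemma measurable_cutoff n (D : set R) : measurable_fun D (cutoff n).
Proof.
apply: measurable_funTS; apply: measurable_fun_ifT => //.
by apply: measurable_fun_ler.
Qed.

Lemma Linfty_cutoff n : Linfty (cutoff n).
Proof.
split; first exact: measurable_cutoff.
by exists n%:R; apply: aeW => x x0; apply: cutoff_bound; exact: ltW.
Qed.

(** Fragments are smaller than their parent. If [y <= n], truncation does not
    affect any fragment and conservation of mass makes the two terms cancel; if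
    [n < y], the parent is truncated away and only the fragments of size at most [n]
    remain, whose mass is at most [y]. *)
Lemma tilde_cutoff (b : R -> R -> R -> R) n y z : daughter_distribution b ->
  0 < y -> 0 < z ->
  `|tilde b (cutoff n) y z| <= if n%:R < y then y else 0.
Proof.
move=> hb y0 z0; rewrite /tilde {2}/cutoff ltNge; case: ifPn => /= yn.
  rewrite [X in X - _](_ : _ = y) ?subrr ?normr0//.
  rewrite -[RHS]/(fine y%:E) -(daughter_mass hb y0 z0); congr fine.
  apply: eq_integral => x; rewrite inE/= in_itv/= => /andP[x0 xy].
  by rewrite /cutoff ifT// (le_trans (ltW xy)).
rewrite subr0 -lee_fin -(daughter_mass hb y0 z0); apply: normr_Rintegral_le => x /=.
rewrite in_itv/= => /andP[x0 xy]; have bx := daughter_ge0 hb x0 y0 z0.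
rewrite lee_fin normrM !ger0_norm ?cutoff_ge0 ?(ltW x0)//.
by apply: ler_wpM2r => //; rewrite cutoff_le// ltW.
Qed.

Lemma integrable_cutoff n (h : R -> R) : Xi0 h ->
  mu.-integrable Rpos (fun x => (cutoff n x * h x)%:E).
Proof.
move=> [mh ih1]; have ih : mu.-integrable Rpos (EFin \o h).
  by apply: eq_integrable ih1 => // x _; rewrite /= mulr1.
apply: (@le_integrable _ _ _ mu _ _ _ (fun x => n%:R%:E * (h x)%:E)%E) => //.
- by apply/measurable_EFinP/measurable_funM => //; exact: measurable_cutoff.
- move=> x /=; rewrite in_itv/= andbT => x0.
  rewrite lee_fin !normrM ler_wpM2r// (ger0_norm (ler0n _ _)).
  exact/cutoff_bound/ltW.
- exact: integrableZl.
Qed.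

Definition truncated_mass n (h : R -> R) : R :=
  \int[mu]_(x in Rpos) (cutoff n x * h x).

(** Weak continuity of the solution applies to the truncated mass, because the
    truncated identity is bounded by [n]. *)
Lemma Xi0_dual_truncated_mass n : Xi0_dual (truncated_mass n).
Proof.
split.
- move=> c u v u1 v1; rewrite /truncated_mass -RintegralZl//;
    last exact: integrable_cutoff.
  rewrite -RintegralD//; last 2 first.
  + by apply: (integrableZl _ c (integrable_cutoff n _ u1)).
  + exact: integrable_cutoff.
  by apply: eq_Rintegral => x _; rewrite mulrDr mulrCA.
- exists n%:R => u u1; rewrite /Xi_norm.
  have [mu1 _] := u1.
  rewrite -ge0_integralZl ?lee_fin//; last 2 first.
  + by apply/measurable_EFinP/measurable_funM => //; exact: measurableT_comp.
  + by move=> x _; rewrite lee_fin mulr1.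
  apply: normr_Rintegral_le => x /=; rewrite in_itv/= andbT => x0.
  rewrite -EFinM lee_fin mulr1 normrM ler_wpM2r//.
  exact/cutoff_bound/ltW.
Qed.

(** Monotone convergence, after replacing [h] by [`|h|] to have nonnegativity at
    every point. *)
Lemma truncated_mass_cvg (h : R -> R) : Xi0 h -> nonneg_ae h ->
  ((truncated_mass n h)%:E @[n --> \oo] --> \int[mu]_(x in Rpos) (x * h x)%:E)%E.
Proof.
move=> h1 h0; have [mh _] := h1.
have -> : (\int[mu]_(x in Rpos) (x * h x)%:E =
           \int[mu]_(x in Rpos) (limn (fun n => (cutoff n x * `|h x|)%:E)))%E.
  have lim_cut x : limn (fun n => (cutoff n x * `|h x|)%:E) = (x * `|h x|)%:E.
    apply: lim_near_cst => //; exists (Num.truncn `|x|).+1 => // n /= xn.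
    rewrite /cutoff ifT// (le_trans (ler_norm _))// ltW//.
    by rewrite (lt_le_trans (truncnS_gt _))// ler_nat.
  under [RHS]eq_integral do rewrite lim_cut.
  apply: ae_eq_integral => //.
  - by apply/measurable_EFinP/measurable_funM.
  - by apply/measurable_EFinP/measurable_funM => //; exact: measurableT_comp.
  - apply: (@filterS _ _ (ae_filter_ringOfSetsType mu) _ _ _ h0) => x {}h0 /=.
    rewrite in_itv/= andbT => x0.
    by rewrite ger0_norm// h0.
have -> : (fun n => (truncated_mass n h)%:E) =
    (fun n => \int[mu]_(x in Rpos) (cutoff n x * `|h x|)%:E)%E.
  apply/funext => n; rewrite /truncated_mass /Rintegral fineK; last first.
    exact: integrable_fin_num (integrable_cutoff n _ h1).
  apply: ae_eq_integral => //.
  - by apply/measurable_EFinP/measurable_funM => //; exact: measurable_cutoff.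
  - apply/measurable_EFinP/measurable_funM => //; first exact: measurable_cutoff.
    exact: measurableT_comp.
  - apply: (@filterS _ _ (ae_filter_ringOfSetsType mu) _ _ _ h0) => x {}h0 /=.
    rewrite in_itv/= andbT => x0.
    by rewrite ger0_norm// h0.
apply: cvg_monotone_convergence => //.
- move=> n; apply/measurable_EFinP/measurable_funM; first exact: measurable_cutoff.
  exact: measurableT_comp.
- move=> n x /=; rewrite in_itv/= andbT => x0.
  by rewrite lee_fin mulr_ge0// cutoff_ge0// ltW.
- move=> x /=; rewrite in_itv/= andbT => x0 m n mn.
  rewrite lee_fin ler_wpM2r// /cutoff; case: ifPn => xm; last first.
    by case: ifP => // _; exact: ltW.
  by rewrite ifT// (le_trans xm)// ler_nat.
Qed.

End mass.

(** * The flux of mass through large sizes *)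

Section flux.
Context {R : realType}.
Local Notation mu := (@lebesgue_measure R).
Local Notation Rpos := (`]0, +oo[%classic : set R).
Local Notation nu := (mu \x sigma_finite_prod mu mu)%E.

Definition box (t : R) : set (R * (R * R)) := `]0, t[ `*` (Rpos `*` Rpos).

Definition particle_size (q : R * (R * R)) : R := q.2.1.

Definition mass_rate (a f : R -> R -> R) (q : R * (R * R)) : R :=
  q.2.1 * a q.2.1 q.2.2 * f q.1 q.2.1 * f q.1 q.2.2.

Variables (a : R -> R -> R) (b : R -> R -> R -> R) (g : R -> R) (T : \bar R)
  (fin : R -> R) (f : R -> R -> R).
Hypotheses (ha : collision_kernel a) (hb : daughter_distribution b)
  (hfin : Xi0 fin) (hf : weak_solution a b g fin T f).
Hypothesis hint : forall t : R, 0 < t -> (t%:E < T)%E ->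
      (@lebesgue_measure R).-integrable `]0, t[
        (fun s : R => (\int[@lebesgue_measure R]_(z in `]0%R, +oo[)
           \int[@lebesgue_measure R]_(y in `]0%R, +oo[)
             (y * a y z * f s y * f s z)%:E)%E).

Lemma measurable_box t : measurable (box t).
Proof. by do 2 apply: measurableX => //. Qed.

Lemma measurable_particle_size t : measurable_fun (box t) particle_size.
Proof.
apply: measurable_funTS.
by apply: (measurableT_comp measurable_fst); exact: measurable_snd.
Qed.

(** Joint measurability in time and sizes comes from the integrability of the
    collision rate, the solution itself being a mere function of time with values in
    measurable functions. *)
Lemma measurable_mass_rate t : 0 < t -> (t%:E < T)%E ->
  measurable_fun (box t) (mass_rate a f).
Proof.
move=> t0 tT.
have := measurable_int _ (weak_sol_integrable hf t0 tT) => /measurable_EFinP mF.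
have := measurable_funM (measurable_particle_size t) mF.
by apply: eq_measurable_fun => q _; rewrite /= /mass_rate /particle_size !mulrA.
Qed.

(** The assumption bounds an iterated integral of the rate, not of its absolute
    value. The two agree, because at each time the solution is nonnegative almost
    everywhere in each size variable. *)
Lemma integrable_mass_rate t : 0 < t -> (t%:E < T)%E ->
  nu.-integrable (box t) (EFin \o mass_rate a f).
Proof.
move=> t0 tT; apply/integrableP; split.
  by apply/measurable_EFinP; exact: measurable_mass_rate.
have /integrableP[_] := hint _ t0 tT; apply: le_lt_trans.
rewrite tonelli_box//; last first.
  apply: measurableT_comp => //.
  by apply/measurable_EFinP; exact: measurable_mass_rate.
apply: le_integral_ae; apply: aeW => s /=; rewrite in_itv/= => /andP[s0 st].
apply: le_trans (lee_abs _).
have sT : (s%:E < T)%E by apply: lt_trans tT; rewrite lte_fin.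
have fs0 := weak_sol_ge0 hf (ltW s0) sT.
apply: le_integral_ae.
apply: (@filterS _ _ (ae_filter_ringOfSetsType mu) _ _ _ fs0) => z fsz /=.
rewrite in_itv/= andbT => z0; apply: le_integral_ae.
apply: (@filterS _ _ (ae_filter_ringOfSetsType mu) _ _ _ fs0) => y fsy /=.
rewrite in_itv/= andbT => y0.
rewrite lee_fin /mass_rate /= ger0_norm//.
by rewrite !mulr_ge0 ?fsz ?fsy ?(ltW y0) ?(kernel_ge0 ha).
Qed.

Definition flux_tail (t : R) (n : nat) : R :=
  (\int[nu]_(q in box t) tail particle_size (mass_rate a f) n q)%R.

Lemma integral_flux_tail t n : 0 < t -> (t%:E < T)%E ->
  (\int[nu]_(q in box t) (tail particle_size (mass_rate a f) n q)%:E =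
   (flux_tail t n)%:E)%E.
Proof.
move=> t0 tT; rewrite /flux_tail /Rintegral fineK//.
apply: (@integrable_fin_num _ _ _ nu); first exact: measurable_box.
apply: (@integrable_tail _ _ _ nu); first exact: measurable_box.
- exact: measurable_particle_size.
- exact: integrable_mass_rate.
Qed.

Lemma flux_tail_cvg0 t : 0 < t -> (t%:E < T)%E ->
  ((flux_tail t n)%:E @[n --> \oo] --> 0)%E.
Proof.
move=> t0 tT.
under eq_fun do rewrite -integral_flux_tail//.
apply: integral_tail_cvg0; first exact: measurable_box.
- exact: measurable_particle_size.
- exact: integrable_mass_rate.
Qed.

(** The bound at the later time [t] serves all times [s <= t]; this uniformity is
    what allows the passage to the limit [s -> 0]. *)
Lemma flux_tail_bound t s n : 0 < s -> s <= t -> (t%:E < T)%E ->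
  `|truncated_mass n (f s) - truncated_mass n fin| <= flux_tail t n.
Proof.
move=> s0 st tT; have t0 : 0 < t := lt_le_trans s0 st.
have sT : (s%:E < T)%E by apply: le_lt_trans tT; rewrite lee_fin.
have [fc _] := weak_sol_continuous hf.
have fs1 := fc s (ltW s0) sT.
have mtail u : 0 < u -> (u%:E < T)%E -> measurable_fun (box u)
    (fun q => (tail particle_size (mass_rate a f) n q)%:E).
  move=> u0 uT; apply/measurable_EFinP; apply: measurable_tail.
  - exact: measurable_box.
  - exact: measurable_particle_size.
  - exact: measurable_mass_rate.
have tail0 q : (0 <= (tail particle_size (mass_rate a f) n q)%:E)%E.
  by rewrite lee_fin /tail; case: ifP.
rewrite -lee_fin -integral_flux_tail//.
apply: (@le_trans _ _ (\int[nu]_(q in box s)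
    (tail particle_size (mass_rate a f) n q)%:E)%E); last first.
  apply: ge0_subset_integral => //; try exact: measurable_box; first exact: mtail.
  move=> [r p] [/=]; rewrite !in_itv/= => /andP[r0 rs] pp; split => //=.
  by rewrite in_itv/= r0 (lt_le_trans rs).
rewrite tonelli_box//; last exact: mtail.
have -> : truncated_mass n (f s) - truncated_mass n fin =
    \int[mu]_(x in Rpos) (cutoff n x * (f s x - fin x)).
  rewrite /truncated_mass -RintegralB//; [|exact: integrable_cutoff..].
  by apply: eq_Rintegral => x _; rewrite mulrBr.
rewrite (weak_sol_eq hf s0 sT (Linfty_cutoff n)).
apply: normr_Rintegral_le => r _; apply: normr_Rintegral_le => z /=.
rewrite in_itv/= andbT => z0; apply: normr_Rintegral_le => y /=.
rewrite in_itv/= andbT => y0; rewrite lee_fin /tail /particle_size /=.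
have := tilde_cutoff _ n _ _ hb y0 z0; rewrite /mass_rate/= -!mulrA normrM.
case: ifP => _ ht.
  by rewrite [leRHS]normrM (ger0_norm (ltW y0)) ler_wpM2r.
by rewrite (le_trans (ler_wpM2r _ ht))// mul0r.
Qed.

(** The bound of [flux_tail_bound] holds at arbitrarily small positive times, and
    the truncated mass is continuous at time [0]. *)
Lemma flux_tail_bound0 t n : 0 < t -> (t%:E < T)%E ->
  `|truncated_mass n (f 0) - truncated_mass n fin| <= flux_tail t n.
Proof.
move=> t0 tT; apply/ler_addgt0Pr => e e0.
have [_ /(_ _ (Xi0_dual_truncated_mass n)) cn] := weak_sol_continuous hf.
have D0 : [set t : R | 0 <= t /\ (t%:E < T)%E] 0.
  by split => //; apply: lt_trans tT; rewrite lte_fin.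
have /subspace_continuousP/(_ 0 D0)/cvgrPdist_lt/(_ _ e0) := cn.
rewrite /within => -[d /= d0 near0].
pose s := Num.min (d / 2) t.
have s0 : 0 < s by rewrite lt_min t0 andbT divr_gt0.
have st : s <= t by rewrite ge_min lexx orbT.
have sd : `|0 - s| < d.
  rewrite sub0r normrN gtr0_norm// gt_min.
  by rewrite ltr_pdivrMr// mulr_natr mulr2n ltrDl d0.
have sT : (s%:E < T)%E by apply: le_lt_trans tT; rewrite lee_fin.
have near_s := near0 s sd (conj (ltW s0) sT).
rewrite -(subrKA (truncated_mass n (f s))) addrC.
rewrite (le_trans (ler_normD _ _))// lerD ?flux_tail_bound// ltW//.
Qed.

(** At [t = 0] any positive time before [T] provides the error sequence. *)
Lemma truncated_mass_near t : 0 <= t -> (t%:E < T)%E ->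
  exists2 e : nat -> R, (e n)%:E @[n --> \oo] --> 0%E &
    forall n, `|truncated_mass n (f t) - truncated_mass n fin| <= e n.
Proof.
rewrite le_eqVlt => /predU1P[<- T0|t0 tT].
- have [u u0 uT] : exists2 u : R, 0 < u & (u%:E < T)%E.
    have [T1|T1] := ltP 1%:E T; first by exists 1.
    have Too : (T < +oo)%E by rewrite (le_lt_trans T1)// ltry.
    have finT : T \is a fin_num by rewrite ge0_fin_numE ?ltW.
    have T'0 : 0 < fine T by rewrite fine_gt0// T0 Too.
    exists (fine T / 2); first by rewrite divr_gt0.
    by rewrite -[ltRHS](fineK finT) lte_fin ltr_pdivrMr// mulr_natr mulr2n ltrDl.
  exists (flux_tail u) => [|n]; first exact: flux_tail_cvg0.
  exact: flux_tail_bound0.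
- exists (flux_tail t) => [|n]; first exact: flux_tail_cvg0.
  exact: flux_tail_bound.
Qed.

End flux.

(** * Conservation of mass *)

Theorem proposition5p1 (R : realType) (a : R -> R -> R) (b : R -> R -> R -> R)
    (g : R -> R) (T : \bar R) (fin : R -> R) (f : R -> R -> R)
    (ha : collision_kernel a) (hb : daughter_distribution b)
    (hg : weight_class b g) (hT : (0 < T)%E)
    (hfin0 : Xi0 fin) (hfing : Xi_pos g fin)
    (hf : weak_solution a b g fin T f)
    (hint : forall t : R, 0 < t -> (t%:E < T)%E ->
      (@lebesgue_measure R).-integrable `]0, t[
        (fun s : R => (\int[@lebesgue_measure R]_(z in `]0%R, +oo[)
           \int[@lebesgue_measure R]_(y in `]0%R, +oo[)
             (y * a y z * f s y * f s z)%:E)%E)) :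
  forall t : R, 0 <= t -> (t%:E < T)%E ->
    (\int[@lebesgue_measure R]_(x in `]0%R, +oo[) (x * f t x)%:E =
     \int[@lebesgue_measure R]_(x in `]0%R, +oo[) (x * fin x)%:E)%E.
Proof.
move=> t t0 tT.
have [e e0 near_e] := truncated_mass_near _ _ _ _ _ _ ha hb hfin0 hf hint _ t0 tT.
have [fc _] := weak_sol_continuous hf.
apply: cvge_eq_near e0 near_e; apply: truncated_mass_cvg => //.
- exact: fc.
- exact: weak_sol_ge0 hf _ t0 tT.
- by case: hfing.
Qed.
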